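(* Let $r,s,t>1$ be integers and $G=C_r*C_s*C_t$. Let $\mathbb F$ be a field of characteristic $0$ containing a root $\mu_1$ of $P_r$, a root $\mu_2$ of $P_s$, a root $\mu_3$ of $P_t$, and elements $s_1,s_2,s_3$ with $s_i^2+\mu_i^2=1$ for $i=1,2,3$ (then each $s_i\neq0$). Let $A=\mathbb F[x,y,u,v]/\langle(1-x^2)(1-y^2)-(u^2+v^2)\rangle$, let $J\lhd A$ be the ideal generated by $u,v,1-x^2,1-y^2$, let $$W=-s_1^2s_2s_3\,xy+\mu_1\mu_3s_1s_2\,x+\mu_1\mu_2s_1s_3\,y+s_1^2\mu_2\mu_3\in A,$$ and let $$M=\begin{pmatrix}u&v&1-x^2&0\\-v&u&0&1-x^2\\1-y^2&0&u&-v\\0&1-y^2&v&u\end{pmatrix}.$$ Suppose that for every $a\in A$ represented by $M$ and every $\alpha\in J$, the elements $a$ and $W+\alpha$ generate a proper ideal of $A$. Then no element $w\in G$ normally generates $G$.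
   Context: The polynomials $P_n\in\mathbb Q[X]$, $n\in\mathbb Z$, are defined by $P_0=0$, $P_1=1$ and $2XP_n(X)=P_{n-1}(X)+P_{n+1}(X)$. An element $a\in A$ is said to be represented by $M$ if there exist column vectors $\mathbf q_1,\mathbf q_2\in A^4$ with $a=\mathbf q_1^{T}M\mathbf q_2$. *)

(* Defs.v *)
From HB Require Import structures.
From mathcomp Require Import all_boot all_order all_algebra.
Set Implicit Arguments. Unset Strict Implicit. Unset Printing Implicit Defensive.
Import Order.TTheory GRing.Theory Num.Theory.
Local Open Scope ring_scope.

Fixpoint Ppair (n : nat) : {poly rat} * {poly rat} :=
  match n with
  | O => (0, 1)
  | S m => let: (a, b) := Ppair m in (b, 2%:R *: 'X * b - a)
  end.
Definition Pq (n : nat) : {poly rat} := (Ppair n).1.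
Definition PF (F : fieldType) (n : nat) : {poly F} := map_poly (@ratr F) (Pq n).

Definition mpoly4 (F : fieldType) := {poly {poly {poly {poly F}}}}.
Definition mC (F : fieldType) (c : F) : mpoly4 F := c%:P%:P%:P%:P.
Definition mx (F : fieldType) : mpoly4 F := ('X : {poly F})%:P%:P%:P.
Definition my (F : fieldType) : mpoly4 F := ('X : {poly {poly F}})%:P%:P.
Definition mu_ (F : fieldType) : mpoly4 F := ('X : {poly {poly {poly F}}})%:P.
Definition mv (F : fieldType) : mpoly4 F := 'X.

Definition Rel (F : fieldType) : mpoly4 F :=
  (1 - mx F ^+ 2) * (1 - my F ^+ 2) - (mu_ F ^+ 2 + mv F ^+ 2).

Definition Wpoly (F : fieldType) (mu1 mu2 mu3 s1 s2 s3 : F) : mpoly4 F :=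
  - mC (s1 ^+ 2 * s2 * s3) * mx F * my F
  + mC (mu1 * mu3 * s1 * s2) * mx F
  + mC (mu1 * mu2 * s1 * s3) * my F
  + mC (s1 ^+ 2 * mu2 * mu3).

Definition Jcomb (F : fieldType) (c1 c2 c3 c4 : mpoly4 F) : mpoly4 F :=
  c1 * mu_ F + c2 * mv F + c3 * (1 - mx F ^+ 2) + c4 * (1 - my F ^+ 2).

Definition Mmat (F : fieldType) : 'M[mpoly4 F]_4 :=
  let x := mx F in let y := my F in let u := mu_ F in let v := mv F in
  let rows : seq (seq (mpoly4 F)) :=
    [:: [:: u; v; 1 - x ^+ 2; 0];
        [:: - v; u; 0; 1 - x ^+ 2];
        [:: 1 - y ^+ 2; 0; u; - v];
        [:: 0; 1 - y ^+ 2; v; u]] in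
  \matrix_(i < 4, j < 4) nth 0 (nth [::] rows i) j.

(* An element of G is represented by a word, i.e. a sequence of syllables
   (i, e) standing for g_i^e, where g_0, g_1, g_2 generate C_r, C_s, C_t.
   Two words represent the same element of G iff they have the same
   reduced normal form (the standard normal form for free products). *)
Definition syllable := ('I_3 * nat)%type.
Definition word := seq syllable.

Definition cord (r s t : nat) (i : 'I_3) : nat := nth 0%N [:: r; s; t] i.

(* push a syllable onto a reversed reduced word *)
Definition push (r s t : nat) (st : word) (x : syllable) : word :=
  let: (i, e) := x in
  let n := cord r s t i in
  let e' := (e %% n)%N in
  if e' == 0%N then st else
  match st with
  | (j, f) :: st' =>
      if j == i then
        (if ((e' + f) %% n == 0)%N then st' else (i, ((e' + f) %% n)%N) :: st')
      else (i, e') :: st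
  | [::] => [:: (i, e')]
  end.

Definition normalize (r s t : nat) (w : word) : word :=
  rev (foldl (push r s t) [::] w).

Definition gmul (u v : word) : word := u ++ v.
Definition ginv (r s t : nat) (u : word) : word :=
  rev (map (fun x : syllable => (x.1, (cord r s t x.1 - x.2 %% cord r s t x.1)%N)) u).
Definition geq (r s t : nat) (u v : word) : Prop := normalize r s t u = normalize r s t v.

Inductive in_normal_closure (r s t : nat) (w : word) : word -> Prop :=
| nc_one : in_normal_closure r s t w [::]
| nc_mul : forall a b, in_normal_closure r s t w a -> in_normal_closure r s t w b ->
    in_normal_closure r s t w (gmul a b)
| nc_conj : forall g, in_normal_closure r s t w (gmul g (gmul w (ginv r s t g)))
| nc_conjinv : forall g,
    in_normal_closure r s t w (gmul g (gmul (ginv r s t w) (ginv r s t g))).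

Definition normally_generates (r s t : nat) (w : word) : Prop :=
  forall g : word, exists n, in_normal_closure r s t w n /\ geq r s t n g.

(* Main.v *)
Require Import Defs.
From HB Require Import structures.
From mathcomp Require Import all_boot all_order all_algebra.
From mathcomp Require Import ring.
Set Implicit Arguments. Unset Strict Implicit. Unset Printing Implicit Defensive.
Import Order.TTheory GRing.Theory Num.Theory.
Local Open Scope ring_scope.

(** Over A there are three unit vectors n1, n2, n3 with n1.n2 = x, n1.n3 = y, and u, v the
    inner product and the oriented area of the components of n2, n3 orthogonal to n1.
    Sending the generators to powers of the unit quaternions mu_i + s_i n_i defines G
    up to signs.  If w normally generates G, its exponent sums are prime to the orders, so
    the powers can be chosen such that w has the same image as the product of the three
    quaternions modulo J, where everything commutes; hence s_1 times the n1-component of w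
    is, up to sign, W + alpha.  Let I be the ideal generated by the n1-component of w and
    the inner products of its orthogonal component w' with all orthogonal vectors.  Modulo I
    the image of w is a scalar, hence so is that of all of G, and s_1 in I shows that I = A.  Since the inner
    product is linear, 1 = f (W + alpha) + <w', e> for a single e, and the inner products of
    orthogonal vectors are exactly the elements represented by M. *)

(** * Congruences on words that respect the relations of the free product *)

Section WordCongruence.
Variables r s t : nat.
Local Notation n := (cord r s t).

(** Only the soundness of the normal form is needed: by [wc_geq], every congruence of this kind
    contains equality in G. The two instances are exponent sums modulo the orders and matrices up to
    sign. *)
Record word_congruence (E : word -> word -> Prop) : Prop := WordCongruence {
  wc_refl : forall u, E u u;
  wc_sym : forall u v, E u v -> E v u;
  wc_trans : forall u v w, E u v -> E v w -> E u w;
  wc_cat : forall u u' v v', E u u' -> E v v' -> E (u ++ v) (u' ++ v');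
  wc_add : forall i e f, E [:: (i, e); (i, f)] [:: (i, (e + f)%N)];
  wc_zero : forall i, E [:: (i, 0%N)] [::];
  wc_order : forall i, E [:: (i, n i)] [::] }.

Variable E : word -> word -> Prop.
Hypothesis Ec : word_congruence E.

Lemma wc_mul_order i k : E [:: (i, (k * n i)%N)] [::].
Proof.
elim: k => [|k IHk]; first exact: wc_zero.
rewrite mulSn; apply: (wc_trans Ec (wc_sym Ec (wc_add Ec _ _ _)) _).
exact: (wc_cat Ec (wc_order Ec i) IHk).
Qed.

Lemma wc_dvd i e : (n i %| e)%N -> E [:: (i, e)] [::].
Proof. by case/dvdnP=> k ->; apply: wc_mul_order. Qed.

Lemma wc_mod i e : E [:: (i, (e %% n i)%N)] [:: (i, e)].
Proof.
rewrite [in X in E _ X](divn_eq e (n i)); apply: (wc_sym Ec).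
apply: (wc_trans Ec (wc_sym Ec (wc_add Ec _ _ _)) _).
exact: (wc_cat Ec (wc_mul_order i _) (wc_refl Ec _)).
Qed.

Lemma wc_push st x : E (rev (push r s t st x)) (rev st ++ [:: x]).
Proof.
have catl u v v' : E v v' -> E (u ++ v) (u ++ v').
  by apply: wc_cat => //; apply: wc_refl.
have tr := wc_trans Ec; have sy := wc_sym Ec; have re := wc_refl Ec.
case: x => i e /=.
case: eqP => [e0|_].
  rewrite -[X in E X _]cats0; apply: catl; apply: (sy _ _); apply: wc_dvd; exact/eqP.
case: st => [|[j f] st]; first exact: wc_mod.
case: eqP => [->|_]; last first.
  by rewrite (rev_cons (i, _)) -cats1; apply: catl; apply: wc_mod.
have Efe : E [:: (i, ((e %% n i + f) %% n i)%N)] [:: (i, f); (i, e)].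
  by apply: (tr _ _ _ _ (sy _ _ (wc_add Ec _ _ _))); rewrite modnDml addnC; apply: wc_mod.
rewrite [rev ((i, f) :: st)]rev_cons -cats1 -catA /=.
case: eqP => [ef0|_].
  rewrite -[X in E X _]cats0; apply: catl; apply: (sy _ _).
  by apply: (tr _ _ _ (sy _ _ Efe)); rewrite ef0; apply: wc_zero.
by rewrite rev_cons -cats1; apply: catl; apply: Efe.
Qed.

Lemma wc_normalize w : E (normalize r s t w) w.
Proof.
rewrite /normalize; elim/last_ind: w => [|w x IHw]; first exact: wc_refl.
rewrite foldl_rcons -cats1; apply: (wc_trans Ec (wc_push _ _) _).
by apply: wc_cat => //; apply: wc_refl.
Qed.

Lemma wc_geq u v : Defs.geq r s t u v -> E u v.
Proof.
move=> uv; apply: (wc_trans Ec (wc_sym Ec (wc_normalize u)) _).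
by rewrite uv; apply: wc_normalize.
Qed.

Hypothesis n_gt0 : forall i, (0 < n i)%N.

Lemma wc_mulV u : E (u ++ ginv r s t u) [::].
Proof.
elim: u => [|[i e] u IHu] /=; first exact: wc_refl.
rewrite /ginv map_cons rev_cons -cats1 /=.
have re := wc_refl Ec.
apply: (wc_trans Ec (v := [:: (i, e)] ++ [::] ++ [:: (i, (n i - e %% n i)%N)])).
  rewrite -[_ :: _]cat1s; apply: (wc_cat Ec) => //.
  by rewrite catA; apply: (wc_cat Ec IHu (re _)).
rewrite /=; apply: (wc_trans Ec (wc_add Ec _ _ _)).
(* [ginv] sends an exponent divisible by the order to the order itself, not to 0; the two exponents
   still add up to a multiple of it. *)
apply: wc_dvd; rewrite {1}(divn_eq e (n i)) -addnA subnKC ?dvdn_addl ?dvdn_mull //.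
exact/ltnW/ltn_pmod.
Qed.

End WordCongruence.

(** * Exponent sums *)

Definition expo (i : 'I_3) (w : word) : nat := \sum_(x <- w | x.1 == i) x.2.

Lemma expo_cat i u v : expo i (u ++ v) = (expo i u + expo i v)%N.
Proof. by rewrite /expo big_cat. Qed.

Lemma expo_cons i j e w : expo i ((j, e) :: w) = ((if j == i then e else 0) + expo i w)%N.
Proof. by rewrite /expo big_cons /=; case: eqP. Qed.

Lemma expo_nil i : expo i [::] = 0%N. Proof. exact: big_nil. Qed.

Lemma expo_congruence r s t i :
  word_congruence r s t (fun u v => expo i u = expo i v %[mod cord r s t i]).
Proof.
split => //.
- by move=> u v w -> ->.
- by move=> u u' v v' uu' vv'; rewrite !expo_cat -modnDm uu' vv' modnDm.
- by move=> j e f; rewrite !expo_cons expo_nil; case: eqP => // _; rewrite !addn0.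
- by move=> j; rewrite !expo_cons expo_nil; case: eqP.
- by move=> j; rewrite !expo_cons expo_nil; case: eqP => // ->; rewrite addn0 modnn mod0n.
Qed.

Section ExponentSum.
Variables r s t : nat.
Hypotheses (r1 : (1 < r)%N) (s1 : (1 < s)%N) (t1 : (1 < t)%N).

Lemma cord_gt1 i : (1 < cord r s t i)%N.
Proof. by case: i => [[|[|[|]]]]. Qed.

Lemma cord_gt0 i : (0 < cord r s t i)%N.
Proof. exact: ltnW (cord_gt1 i). Qed.

Lemma expo_mulV i g : (cord r s t i %| expo i g + expo i (ginv r s t g))%N.
Proof.
rewrite -expo_cat /dvdn.
have := wc_mulV (expo_congruence r s t i) cord_gt0 g.
by rewrite /= expo_nil mod0n => ->.
Qed.

(** A common divisor of the order and of the exponent sum of w divides the exponent sum of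
    everything in the normal closure, hence that of the i-th generator, which is 1 modulo the
    order. *)
Lemma normally_generates_coprime w i :
  normally_generates r s t w -> coprime (expo i w) (cord r s t i).
Proof.
move=> gen; have [v [nc_v /(wc_geq (expo_congruence r s t i)) /= vE]] := gen [:: (i, 1%N)].
rewrite expo_cons expo_nil eqxx addn0 in vE.
set d := gcdn (expo i w) (cord r s t i).
have dw : (d %| expo i w)%N by apply: dvdn_gcdl.
have dn : (d %| cord r s t i)%N by apply: dvdn_gcdr.
have dV g : (d %| expo i g + expo i (ginv r s t g))%N.
  exact: dvdn_trans dn (expo_mulV i g).
have dv : (d %| expo i v)%N.
  elim: nc_v => [|a b _ da _ db|g|g]; rewrite /gmul ?expo_nil ?dvdn0 // !expo_cat.
  - by rewrite dvdn_add.
  - by rewrite addnCA dvdn_add.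
  - by rewrite addnCA dvdn_add // -(dvdn_addr _ dw).
rewrite /coprime -/d -dvdn1.
move: dv; rewrite (divn_eq (expo i v) (cord r s t i)) vE modn_small ?cord_gt1 //.
by rewrite dvdn_addr // dvdn_mull.
Qed.

Lemma normally_generates_inverse w i :
  normally_generates r s t w ->
  exists a k, (a * expo i w = 1 + k * cord r s t i)%N.
Proof.
move=> /(@normally_generates_coprime _ i) co.
(* Bezout over the naturals needs a positive exponent sum; 0 would be coprime only to the order
   1. *)
have e0 : (0 < expo i w)%N.
  case: posnP co => // ->; rewrite /coprime gcd0n => /eqP n1.
  by have := cord_gt1 i; rewrite n1.
have [[a k] /= ak] := coprimeP _ e0 co.
by exists a, k; rewrite -ak subnK // ltnW // -subn_gt0 ak.
Qed.
End ExponentSum.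

(** * Complex numbers over a ring, as pairs *)

Definition cmul {R : pzRingType} (z z' : R * R) : R * R :=
  (z.1 * z'.1 - z.2 * z'.2, z.1 * z'.2 + z.2 * z'.1).

Definition cpow {R : pzRingType} (z : R * R) (k : nat) : R * R :=
  iter k (cmul z) (1, 0).

Lemma cpowD (R : comPzRingType) (z : R * R) k l :
  cpow z (k + l) = cmul (cpow z k) (cpow z l).
Proof.
elim: k => [|k IHk]; rewrite /cpow /cmul /=.
  by rewrite !mul1r !mul0r subr0 addr0; case: (iter _ _ _).
rewrite -!/(cpow z _) IHk /cmul /=; congr pair; ring.
Qed.

(** * Quaternions, their matrices and the Gram matrix *)

Section Quaternion.
Variables (R : comNzRingType) (x y u v : R).

(* Quat stands for w = alpha + p z2 + q z3 with complex alpha = qre + i qim,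
   p = qp0 + i qp1, q = qq0 + i qq1, where z2, z3 are the components of the second and
   third axis orthogonal to the first, seen as complex numbers with |z2|^2 = 1 - x^2,
   |z3|^2 = 1 - y^2 and z2 (conj z3) = u + i v. *)
Record quat := Quat { qre : R; qim : R; qp0 : R; qp1 : R; qq0 : R; qq1 : R }.

(* gb = (p z2 + q z3) (conj z2) and gd = (p z2 + q z3) (conj z3). *)
Definition gb0 (w : quat) := qp0 w * (1 - x ^+ 2) + qq0 w * u + qq1 w * v.
Definition gb1 (w : quat) := qp1 w * (1 - x ^+ 2) + qq1 w * u - qq0 w * v.
Definition gd0 (w : quat) := qp0 w * u - qp1 w * v + qq0 w * (1 - y ^+ 2).
Definition gd1 (w : quat) := qp0 w * v + qp1 w * u + qq1 w * (1 - y ^+ 2).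

(** Its vanishing says that |z2|^2 |z3|^2 = |z2 (conj z3)|^2; it is the relation that defines A. *)
Definition gram_rel := (1 - x ^+ 2) * (1 - y ^+ 2) - (u ^+ 2 + v ^+ 2).

(** The product of alpha + beta j and alpha' + beta' j with j alpha = (conj alpha) j and beta = p z2
    + q z3; the term beta (conj beta') is expanded through [gb0], [gb1], [gd0], [gd1]. *)
Definition qmul (w z : quat) : quat :=
  Quat (qre w * qre z - qim w * qim z
        - (qp0 z * gb0 w + qp1 z * gb1 w + qq0 z * gd0 w + qq1 z * gd1 w))
       (qre w * qim z + qim w * qre z
        - (qp0 z * gb1 w - qp1 z * gb0 w + qq0 z * gd1 w - qq1 z * gd0 w))
       (qre w * qp0 z - qim w * qp1 z + qp0 w * qre z + qp1 w * qim z)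
       (qre w * qp1 z + qim w * qp0 z + qp1 w * qre z - qp0 w * qim z)
       (qre w * qq0 z - qim w * qq1 z + qq0 w * qre z + qq1 w * qim z)
       (qre w * qq1 z + qim w * qq0 z + qq1 w * qre z - qq0 w * qim z).

Definition qconj (w : quat) : quat :=
  Quat (qre w) (- qim w) (- qp0 w) (- qp1 w) (- qq0 w) (- qq1 w).

Definition mx6 (rows : seq (seq R)) : 'M[R]_6 :=
  \matrix_(i < 6, j < 6) nth 0 (nth [::] rows i) j.

(* The real form of left multiplication by w on alpha + (conj z2) h1 + (conj z3) h2; as z2
   and z3 are dependent, it is multiplicative only after multiplication by gram and modulo
   gram_rel. *)
Definition qmx (w : quat) : 'M[R]_6 := mx6
  [:: [:: qre w; - qim w; gb0 w; - gb1 w; gd0 w; - gd1 w];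
      [:: qim w; qre w; gb1 w; gb0 w; gd1 w; gd0 w];
      [:: - qp0 w; - qp1 w; qre w; qim w; 0; 0];
      [:: qp1 w; - qp0 w; - qim w; qre w; 0; 0];
      [:: - qq0 w; - qq1 w; 0; 0; qre w; qim w];
      [:: qq1 w; - qq0 w; 0; 0; - qim w; qre w]].

Definition gram : 'M[R]_6 := mx6
  [:: [:: 1; 0; 0; 0; 0; 0];
      [:: 0; 1; 0; 0; 0; 0];
      [:: 0; 0; 1 - x ^+ 2; 0; u; - v];
      [:: 0; 0; 0; 1 - x ^+ 2; v; u];
      [:: 0; 0; u; v; 1 - y ^+ 2; 0];
      [:: 0; 0; - v; u; 0; 1 - y ^+ 2]].

(* With p, q and p', q' the complex components of w and z, these are the blocks
   q' (conj q), - (conj p) q', - (conj q) p' and (conj p) p'. *)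
Definition qdefect (w z : quat) : 'M[R]_6 :=
  let a0 := qq0 w * qq0 z + qq1 w * qq1 z in
  let a1 := qq0 w * qq1 z - qq1 w * qq0 z in
  let b0 := - (qp0 w * qq0 z + qp1 w * qq1 z) in
  let b1 := - (qp0 w * qq1 z - qp1 w * qq0 z) in
  let c0 := - (qq0 w * qp0 z + qq1 w * qp1 z) in
  let c1 := - (qq0 w * qp1 z - qq1 w * qp0 z) in
  let d0 := qp0 w * qp0 z + qp1 w * qp1 z in
  let d1 := qp0 w * qp1 z - qp1 w * qp0 z in
  mx6 [:: [::]; [::];
       [:: 0; 0; a0; - a1; b0; - b1]; [:: 0; 0; a1; a0; b1; b0];
       [:: 0; 0; c0; - c1; d0; - d1]; [:: 0; 0; c1; c0; d1; d0]].

(** Left multiplication by the conjugate quaternion is adjoint for the Gram form. This allows a left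
    factor to be moved across [gram]. *)
Lemma gram_qmx w : gram *m qmx w = (qmx (qconj w))^T *m gram.
Proof.
case: w => w0 w1 p0 p1 q0 q1.
apply/matrixP => i j; rewrite !mxE !big_ord_recr !big_ord0 /=.
rewrite !mxE.
case: i => [[|[|[|[|[|[|//]]]]]] ?]; case: j => [[|[|[|[|[|[|//]]]]]] ?] /=;
rewrite /qmx /gram /qconj /gb0 /gb1 /gd0 /gd1 /=; ring.
Qed.

Lemma gram_qmxM w z :
  gram *m (qmx w *m qmx z) = gram *m qmx (qmul w z) + gram_rel *: qdefect w z.
Proof.
case: w => w0 w1 p0 p1 q0 q1; case: z => z0 z1 s0 s1 t0 t1.
apply/matrixP => i j; rewrite !mxE !big_ord_recr !big_ord0 /=.
rewrite !mxE !big_ord_recr !big_ord0 /= !mxE.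
case: i => [[|[|[|[|[|[|//]]]]]] ?]; case: j => [[|[|[|[|[|[|//]]]]]] ?] /=;
rewrite /qmx /gram /qmul /gram_rel /gb0 /gb1 /gd0 /gd1 /=; ring.
Qed.
End Quaternion.

Lemma cmulA (R : comPzRingType) (a b c : R * R) : cmul a (cmul b c) = cmul (cmul a b) c.
Proof. by rewrite /cmul /=; congr pair; ring. Qed.

Lemma cmulC (R : comPzRingType) (a b : R * R) : cmul a b = cmul b a.
Proof. by rewrite /cmul /=; congr pair; ring. Qed.

Lemma cmulCA (R : comPzRingType) (a b c : R * R) : cmul a (cmul b c) = cmul b (cmul a c).
Proof. by rewrite !cmulA (cmulC a). Qed.

Lemma cpow_sign (R : comPzRingType) (z : R * R) n (b : bool) k :
  cpow z n = ((-1) ^+ b, 0) -> exists b' : bool, cpow z (k * n) = ((-1) ^+ b', 0).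
Proof.
move=> zn; elim: k => [|k [b' IHk]]; first by exists false.
exists (b (+) b'); rewrite mulSn cpowD zn IHk signr_addb /cmul /=.
by rewrite !mulr0 !mul0r subr0 addr0.
Qed.

(** * Congruences modulo an ideal, without forming the quotient *)

Record prop_ideal (R : pzRingType) (I : R -> Prop) : Prop := PropIdeal {
  ideal_zero : I 0;
  ideal_add : forall a b, I a -> I b -> I (a + b);
  ideal_mul : forall c a, I a -> I (c * a) }.

Section Ideal.
Variables (R : comPzRingType) (I : R -> Prop).
Hypothesis idI : prop_ideal I.

Lemma ideal_mulr a c : I a -> I (a * c).
Proof. by rewrite mulrC; apply: (ideal_mul idI). Qed.

Lemma ideal_sub a b : I a -> I b -> I (a - b).
Proof. by move=> Ia Ib; apply: (ideal_add idI) => //; rewrite -mulN1r; apply: (ideal_mul idI). Qed.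

Lemma ideal_sum (T : finType) (F : T -> R) : (forall i, I (F i)) -> I (\sum_i F i).
Proof.
by move=> IF; elim/big_ind: _ => //; [apply: (ideal_zero idI) | apply: (ideal_add idI)].
Qed.

Definition eqm (z z' : R * R) := I (z.1 - z'.1) /\ I (z.2 - z'.2).

Lemma eqm_refl z : eqm z z.
Proof. by split; rewrite subrr; apply: (ideal_zero idI). Qed.

Lemma eqm_trans a b c : eqm a b -> eqm b c -> eqm a c.
Proof.
move=> [ab1 ab2] [bc1 bc2]; split.
  by rewrite -(subrK b.1 a.1) -addrA; apply: (ideal_add idI).
by rewrite -(subrK b.2 a.2) -addrA; apply: (ideal_add idI).
Qed.

Lemma eqm_cmul a b b' : eqm b b' -> eqm (cmul a b) (cmul a b').
Proof.
case=> b1 b2; split => /=.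
  rewrite (_ : _ - _ = a.1 * (b.1 - b'.1) - a.2 * (b.2 - b'.2)); last by ring.
  by apply: ideal_sub; apply: (ideal_mul idI).
rewrite (_ : _ - _ = a.1 * (b.2 - b'.2) + a.2 * (b.1 - b'.1)); last by ring.
by apply: (ideal_add idI); apply: (ideal_mul idI).
Qed.

Definition twist (e : R) (z : R * R) := (z.1, z.2 * e).

(** Modulo the ideal e squares to 1, so e i is again a square root of -e^2 = -1. *)
Lemma eqm_twist e z z' :
  I (1 - e ^+ 2) -> eqm (cmul (twist e z) (twist e z')) (twist e (cmul z z')).
Proof.
move=> Ie; split => /=.
  rewrite (_ : _ - _ = z.2 * z'.2 * (1 - e ^+ 2)); last by ring.
  exact: (ideal_mul idI).
rewrite (_ : _ - _ = 0); last by ring.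
exact: (ideal_zero idI).
Qed.
End Ideal.

(** * Matrices modulo I after multiplication by the Gram matrix *)

Section GramCongruence.
Variables (R : comNzRingType) (x y u v : R) (I : R -> Prop).
Hypotheses (idI : prop_ideal I) (Irel : I (gram_rel x y u v)).
Local Notation gram := (gram x y u v).
Local Notation qmx := (qmx x y u v).
Local Notation qmul := (qmul x y u v).

Definition gram_in (m : 'M[R]_6) := forall i j, I ((gram *m m) i j).

Lemma gram_in0 : gram_in 0.
Proof. by move=> i j; rewrite mulmx0 mxE; apply: (ideal_zero idI). Qed.

Lemma gram_inD m k : gram_in m -> gram_in k -> gram_in (m + k).
Proof. by move=> Im Ik i j; rewrite mulmxDr mxE; apply: (ideal_add idI). Qed.

Lemma gram_inZ c m : gram_in m -> gram_in (c *: m).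
Proof. by move=> Im i j; rewrite -scalemxAr mxE; apply: (ideal_mul idI). Qed.

Lemma gram_inB m k : gram_in m -> gram_in k -> gram_in (m - k).
Proof. by move=> Im Ik; apply: gram_inD => //; rewrite -scaleN1r; apply: gram_inZ. Qed.

Lemma gram_in_scale c m : I c -> gram_in (c *: m).
Proof. by move=> Ic i j; rewrite -scalemxAr mxE; apply: (ideal_mulr idI). Qed.

Lemma gram_inMr m k : gram_in m -> gram_in (m *m k).
Proof.
move=> Im i j; rewrite mulmxA mxE; apply: ideal_sum => // l.
exact: (ideal_mulr idI).
Qed.

Definition gram_adj (k : 'M[R]_6) := exists k', gram *m k = k' *m gram.

(** The left factor crosses [gram] and becomes its adjoint; right factors need no such condition. *)
Lemma gram_inMl k m : gram_adj k -> gram_in m -> gram_in (k *m m).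
Proof.
move=> [k' kE] Im i j; rewrite mulmxA kE -mulmxA mxE; apply: ideal_sum => // l.
exact: (ideal_mul idI).
Qed.

Lemma gram_adjM k l : gram_adj k -> gram_adj l -> gram_adj (k *m l).
Proof.
move=> [k' kE] [l' lE]; exists (k' *m l').
by rewrite mulmxA kE -mulmxA lE mulmxA.
Qed.

Lemma gram_adj1 : gram_adj 1%:M.
Proof. by exists 1%:M; rewrite mulmx1 mul1mx. Qed.

Lemma gram_adj_qmx w : gram_adj (qmx w).
Proof. by exists (qmx (qconj w))^T; apply: gram_qmx. Qed.

(** The first two rows of [gram] are those of the identity, so multiplication by it loses nothing of
    the first two rows of m. *)
Lemma gram_row0 (m : 'M[R]_6) j : (gram *m m) 0 j = m 0 j.
Proof. by rewrite mxE !big_ord_recl big_ord0 !mxE /= !mul0r !addr0 mul1r. Qed.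

Lemma gram_row1 (m : 'M[R]_6) j : (gram *m m) 1 j = m 1 j.
Proof.
rewrite mxE (bigD1 (1 : 'I_6)) //= !mxE /= mul1r big1 ?addr0 //.
by case=> [[|[|[|[|[|[|//]]]]]] ?] //= _; rewrite !mxE mul0r.
Qed.

Lemma gram_in_qmxM w z : gram_in (qmx w *m qmx z - qmx (qmul w z)).
Proof.
move=> i j; rewrite mulmxBr gram_qmxM addrC addKr mxE.
exact: (ideal_mulr idI).
Qed.

Definition gram_scalar (m : 'M[R]_6) := exists c, gram_in (m - c%:M).

Lemma gram_scalarM m k : gram_scalar m -> gram_scalar k -> gram_scalar (m *m k).
Proof.
move=> [c mc] [d kd]; exists (c * d).
rewrite (_ : _ - _ = (m - c%:M) *m k + c *: (k - d%:M)).
  by apply: gram_inD; [apply: gram_inMr | apply: gram_inZ].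
by rewrite mulmxBl mul_scalar_mx scalerBr scale_scalar_mx addrA subrK.
Qed.

(* The scalar c is invertible modulo I, with inverse the corner entry of the inverse matrix. *)
Lemma gram_scalar_inv m k (b : bool) :
  gram_scalar m -> gram_in (m *m k - ((-1) ^+ b)%:M) -> gram_scalar k.
Proof.
move=> [c mc] mk; set e : R := (-1) ^+ b in mk *.
have ck : gram_in (c *: k - e%:M).
  rewrite (_ : _ - _ = (m *m k - e%:M) - (m - c%:M) *m k).
    by apply: gram_inB => //; apply: gram_inMr.
  by rewrite mulmxBl mul_scalar_mx opprB [RHS]addrC addrA subrK.
have ee : e * e = 1 by rewrite -expr2 sqrr_sign.
set d := e * k 0 0.
have cd : I (c * d - 1).
  have := ideal_mul idI e (ck 0 0); rewrite gram_row0 !mxE mulr1n mulrBr ee.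
  by rewrite /d mulrCA.
exists (d * e).
rewrite (_ : _ - _ = d *: (c *: k - e%:M) - (c * d - 1) *: k).
  by apply: gram_inB; [apply: gram_inZ | apply: gram_in_scale].
by apply/matrixP => i j; rewrite !mxE; case: eqP => _; rewrite ?mulr0n ?mulr1n; ring.
Qed.

(** Write k m l = k (m - c) l + c k l, where k l is a sign. *)
Lemma gram_scalar_conj m k l (b : bool) : gram_adj k -> gram_scalar m ->
  gram_in (k *m l - ((-1) ^+ b)%:M) -> gram_scalar (k *m (m *m l)).
Proof.
move=> adjk [c mc] kl; exists (c * (-1) ^+ b).
rewrite (_ : _ - _ = k *m ((m - c%:M) *m l) + c *: (k *m l - ((-1) ^+ b)%:M)).
  by apply: gram_inD; [apply/gram_inMl/gram_inMr | apply: gram_inZ].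
by rewrite mulmxBl mulmxBr scalerBr scale_scalar_mx mul_scalar_mx -scalemxAr addrA subrK.
Qed.

(** The matrix of w contains the bare coefficients p and q, which need not lie in I; multiplication
    by [gram] turns them into the inner products [gb0] to [gd1]. *)
Lemma gram_scalar_qmx w : I (qim w) -> I (gb0 x u v w) -> I (gb1 x u v w) ->
  I (gd0 y u v w) -> I (gd1 y u v w) -> gram_scalar (qmx w).
Proof.
move=> I1 I2 I3 I4 I5; exists (qre w) => i j.
(* The constant matrices are the coefficients of the five generators; missing entries of a row in
   [mx6] are 0. *)
rewrite (_ : gram *m _ = qim w *: (gram *m qmx (Quat 0 1 0 0 0 0))
  + gb0 x u v w *: mx6 [:: [:: 0; 0; 1]; [:: 0; 0; 0; 1]; [:: -1]; [:: 0; -1]; [::]; [::]]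
  + gb1 x u v w *: mx6 [:: [:: 0; 0; 0; -1]; [:: 0; 0; 1]; [:: 0; -1]; [:: 1]; [::]; [::]]
  + gd0 y u v w *: mx6 [:: [:: 0; 0; 0; 0; 1]; [:: 0; 0; 0; 0; 0; 1]; [::]; [::];
      [:: -1]; [:: 0; -1]]
  + gd1 y u v w *: mx6 [:: [:: 0; 0; 0; 0; 0; -1]; [:: 0; 0; 0; 0; 1]; [::]; [::];
      [:: 0; -1]; [:: 1]]).
  have addI (a b : 'M[R]_6) : I (a i j) -> I (b i j) -> I ((a + b) i j).
    by move=> Ia Ib; rewrite mxE; apply: (ideal_add idI).
  have scaleI c (a : 'M[R]_6) : I c -> I ((c *: a) i j).
    by move=> Ic; rewrite mxE; apply: (ideal_mulr idI).
  by do 4 (apply: (addI _ _); last exact: (scaleI _ _)); exact: (scaleI _ _).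
case: w {I1 I2 I3 I4 I5} => w0 w1 p0 p1 q0 q1; apply/matrixP => {}i {}j.
rewrite !mxE !big_ord_recr !big_ord0 /= !mxE.
case: i => [[|[|[|[|[|[|//]]]]]] ?]; case: j => [[|[|[|[|[|[|//]]]]]] ?] /=;
rewrite /gb0 /gb1 /gd0 /gd1 /= ?mulr0n ?mulr1n; ring.
Qed.
End GramCongruence.

(** * The projective representation of G on words *)

Section WordMatrix.
Variables (R : comNzRingType) (x y u v : R) (rot : 'I_3 -> nat -> R * R).
Local Notation gram := (gram x y u v).
Local Notation qmx := (qmx x y u v).
Local Notation qmul := (qmul x y u v).
Local Notation gram_rel := (gram_rel x y u v).

(** The unit vectors n1 = i, n2 = x i + z2 j and n3 = y i + z3 j. *)
Definition axis (i : 'I_3) : quat R :=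
  nth (Quat 0 0 0 0 0 0) [:: Quat 0 1 0 0 0 0; Quat 0 x 1 0 0 0; Quat 0 y 0 0 1 0] i.

Definition about (z : R * R) (a : quat R) : quat R :=
  Quat (z.1 + z.2 * qre a) (z.2 * qim a) (z.2 * qp0 a) (z.2 * qp1 a)
       (z.2 * qq0 a) (z.2 * qq1 a).

(** Each axis squares to -1, so quaternions about one axis multiply like complex numbers. *)
Lemma about_mul i z z' :
  qmul (about z (axis i)) (about z' (axis i)) = about (cmul z z') (axis i).
Proof.
case: i => [[|[|[|//]]] ?]; rewrite /axis /about /cmul /qmul /gb0 /gb1 /gd0 /gd1 /=;
congr Quat; ring.
Qed.

Lemma qmx_sign (b : bool) a : qmx (about ((-1) ^+ b, 0) a) = ((-1) ^+ b)%:M.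
Proof.
apply/matrixP => i j; rewrite !mxE.
case: i => [[|[|[|[|[|[|//]]]]]] ?]; case: j => [[|[|[|[|[|[|//]]]]]] ?] /=;
rewrite /gb0 /gb1 /gd0 /gd1 /= ?mulr0n ?mulr1n; ring.
Qed.

Definition quat_syl (a : syllable) : quat R := about (rot a.1 a.2) (axis a.1).

Definition quat_word (w : word) : quat R :=
  foldr (fun a q => qmul (quat_syl a) q) (Quat 1 0 0 0 0 0) w.

(** Matrices turn concatenation into an exact product; [quat_word] supplies the components that
    generate I. *)
Definition mx_word (w : word) : 'M[R]_6 :=
  foldr (fun a m => qmx (quat_syl a) *m m) 1%:M w.

Lemma mx_word_cat w z : mx_word (w ++ z) = mx_word w *m mx_word z.
Proof. by elim: w => [|a w /= ->]; rewrite ?mul1mx ?mulmxA. Qed.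

Lemma mx_word_nil : mx_word [::] = 1%:M.
Proof. by []. Qed.

Lemma mx_word_cons a w : mx_word (a :: w) = qmx (quat_syl a) *m mx_word w.
Proof. by []. Qed.

Lemma mx_word1 a : mx_word [:: a] = qmx (quat_syl a).
Proof. exact: mulmx1. Qed.

Lemma gram_adj_mx_word w : gram_adj x y u v (mx_word w).
Proof.
elim: w => [|a w IHw]; first by rewrite mx_word_nil; apply: gram_adj1.
by rewrite mx_word_cons; apply: gram_adjM => //; apply: gram_adj_qmx.
Qed.

Variable I : R -> Prop.
Hypotheses (idI : prop_ideal I) (Irel : I gram_rel).

(** Each multiplication contributes a defect that is a multiple of [gram_rel], and the error of the
    tail passes the left factor by adjointness. *)
Lemma gram_in_quat_word w : gram_in x y u v I (mx_word w - qmx (quat_word w)).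
Proof.
elim: w => [|a w IHw].
  have /= := @qmx_sign false (Quat 0 0 0 0 0 0).
  rewrite /about /= !mul0r addr0 expr0 => ->.
  by rewrite subrr; apply: gram_in0.
rewrite mx_word_cons -(subrK (qmx (quat_syl a) *m qmx (quat_word w)) (_ *m _)) -addrA.
apply: gram_inD => //; last exact: gram_in_qmxM.
by rewrite -mulmxBr; apply: gram_inMl => //; apply: gram_adj_qmx.
Qed.

Variables r s t : nat.
Hypothesis cord_gt0 : forall i, (0 < cord r s t i)%N.
Hypothesis rot0 : forall i, rot i 0 = (1, 0).
Hypothesis rotD : forall i e f, rot i (e + f) = cmul (rot i e) (rot i f).
Hypothesis rot_order : forall i, exists b : bool, rot i (cord r s t i) = ((-1) ^+ b, 0).

(* The generators have order n_i only up to sign. *)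
Definition mx_eqs (w z : word) : Prop :=
  exists b : bool, gram_in x y u v I (mx_word w - (-1) ^+ b *: mx_word z).

Lemma mx_eqs_congruence : word_congruence r s t mx_eqs.
Proof.
split.
- by move=> w; exists false; rewrite expr0 scale1r subrr; apply: gram_in0.
- move=> w z [b wz]; exists b.
  rewrite (_ : _ - _ = - (-1) ^+ b *: (mx_word w - (-1) ^+ b *: mx_word z)).
    exact: gram_inZ.
  by rewrite scalerBr scalerA mulNr -expr2 sqrr_sign scaleN1r scaleNr opprK addrC.
- move=> w z o [b wz] [b' zo]; exists (b (+) b').
  rewrite (_ : _ - _ = (mx_word w - (-1) ^+ b *: mx_word z)
    + (-1) ^+ b *: (mx_word z - (-1) ^+ b' *: mx_word o)).
    by apply: gram_inD => //; apply: gram_inZ.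
  by rewrite scalerBr scalerA signr_addb addrA subrK.
- move=> w w' z z' [b ww'] [b' zz']; exists (b (+) b'); rewrite !mx_word_cat.
  rewrite (_ : _ - _ = (mx_word w - (-1) ^+ b *: mx_word w') *m mx_word z
    + (-1) ^+ b *: (mx_word w' *m (mx_word z - (-1) ^+ b' *: mx_word z'))).
    apply: gram_inD => //; first exact: gram_inMr.
    by apply: gram_inZ => //; apply: gram_inMl => //; apply: gram_adj_mx_word.
  rewrite mulmxBl mulmxBr scalerBr -scalemxAl -scalemxAr scalerA signr_addb.
  by rewrite addrA subrK.
- move=> i e f; exists false; rewrite expr0 scale1r mx_word_cons !mx_word1.
  rewrite {3}/quat_syl /= rotD -about_mul.
  exact: gram_in_qmxM.
- move=> i; exists false; rewrite mx_word1 mx_word_nil /quat_syl /= rot0.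
  by rewrite -[1](expr0 (-1)) (@qmx_sign false) expr0 scale1r subrr; apply: gram_in0.
move=> i; have [b rb] := rot_order i; exists b.
rewrite mx_word1 mx_word_nil /quat_syl /= rb qmx_sign scale_scalar_mx mulr1 subrr.
exact: gram_in0.
Qed.

Lemma gram_scalar_closure w n :
  gram_scalar x y u v I (mx_word w) -> in_normal_closure r s t w n ->
  gram_scalar x y u v I (mx_word n).
Proof.
have mulV g : exists b : bool,
    gram_in x y u v I (mx_word g *m mx_word (ginv r s t g) - ((-1) ^+ b)%:M).
  have [b] := wc_mulV mx_eqs_congruence cord_gt0 g; exists b.
  by rewrite -mx_word_cat -[(_)%:M]scalemx1 -mx_word_nil.
move=> sw; elim=> [|a b _ sa _ sb|g|g]; rewrite /gmul ?mx_word_cat.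
- by exists 1; rewrite mx_word_nil subrr; apply: gram_in0.
- exact: gram_scalarM.
- have [b gV] := mulV g; apply: gram_scalar_conj gV => //.
  exact: gram_adj_mx_word.
have [b gV] := mulV g; have [b' wV] := mulV w.
apply: gram_scalar_conj gV => //; first exact: gram_adj_mx_word.
exact: gram_scalar_inv wV.
Qed.

Lemma normally_generates_ideal w i e :
  normally_generates r s t w -> I (qim (quat_word w)) ->
  I (gb0 x u v (quat_word w)) -> I (gb1 x u v (quat_word w)) ->
  I (gd0 y u v (quat_word w)) -> I (gd1 y u v (quat_word w)) ->
  I (qim (quat_syl (i, e))).
Proof.
move=> gen I1 I2 I3 I4 I5.
have [n [nc_n /(wc_geq mx_eqs_congruence) nE]] := gen [:: (i, e)].
have [b] := wc_sym mx_eqs_congruence nE.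
have [c nc] : gram_scalar x y u v I (mx_word n).
  apply: gram_scalar_closure nc_n.
  have [c wc] := @gram_scalar_qmx _ x y u v I idI _ I1 I2 I3 I4 I5.
  exists c; rewrite -(subrK (qmx (quat_word w)) (mx_word w)) -addrA.
  by apply: gram_inD => //; apply: gram_in_quat_word.
rewrite mx_word1 => gn.
(* The entry in row 1 and column 0 is [qim] of the syllable on one side and 0 in a scalar matrix. *)
have := gram_inD idI gn (gram_inZ idI ((-1) ^+ b) nc) 1 0.
by rewrite scalerBr addrA subrK gram_row1 !mxE /= mulr0n mulr0 subr0.
Qed.
End WordMatrix.

(** * The image of w modulo J *)

(* Modulo J the off-diagonal parts do not contribute to products, so that the diagonal
   becomes multiplicative. *)
Section Abelianization.
Variables (R : comNzRingType) (x y u v : R) (J : R -> Prop).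
Hypotheses (idJ : prop_ideal J) (Jx : J (1 - x ^+ 2)) (Jy : J (1 - y ^+ 2)).
Hypotheses (Ju : J u) (Jv : J v).

Definition diag (q : quat R) : R * R := (qre q, qim q).

Lemma diag_mul q q' : eqm J (diag (qmul x y u v q q')) (cmul (diag q) (diag q')).
Proof.
have J1 : J (gb0 x u v q).
  by rewrite /gb0; do !apply: (ideal_add idJ) => //; apply: (ideal_mul idJ).
have J2 : J (gb1 x u v q).
  by rewrite /gb1; apply: ideal_sub => //; first apply: (ideal_add idJ) => //;
    apply: (ideal_mul idJ).
have J3 : J (gd0 y u v q).
  by rewrite /gd0; apply: (ideal_add idJ) => //; first apply: ideal_sub => //;
    apply: (ideal_mul idJ).
have J4 : J (gd1 y u v q).
  by rewrite /gd1; do !apply: (ideal_add idJ) => //; apply: (ideal_mul idJ).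
split=> /=.
  rewrite addrC addKr -[X in J X]add0r; apply: ideal_sub => //; first exact: (ideal_zero idJ).
  by do !apply: (ideal_add idJ) => //; apply: (ideal_mul idJ).
rewrite addrC addKr -[X in J X]add0r; apply: ideal_sub => //; first exact: (ideal_zero idJ).
apply: ideal_sub => //; last exact: (ideal_mul idJ).
apply: (ideal_add idJ) => //; last exact: (ideal_mul idJ).
by apply: ideal_sub => //; apply: (ideal_mul idJ).
Qed.

Variable rot : 'I_3 -> nat -> R * R.
Hypothesis rot0 : forall i, rot i 0 = (1, 0).
Hypothesis rotD : forall i e f, rot i (e + f) = cmul (rot i e) (rot i f).

Local Notation g0 := (@Ordinal 3 0 isT).
Local Notation g1 := (@Ordinal 3 1 isT).
Local Notation g2 := (@Ordinal 3 2 isT).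

(** Modulo J the axes have n1-components 1, x, y of square 1, so the syllables become commuting
    complex numbers and can be collected generator by generator. *)
Lemma diag_quat_word w :
  eqm J (diag (quat_word x y u v rot w))
    (cmul (twist 1 (rot g0 (expo g0 w)))
      (cmul (twist x (rot g1 (expo g1 w))) (twist y (rot g2 (expo g2 w))))).
Proof.
elim: w => [|[i e] w IHw] /=.
  rewrite !expo_nil !rot0 /cmul /twist /=.
  by rewrite !(mul0r, mulr0, subr0, addr0, mulr1); apply: eqm_refl.
apply: eqm_trans (diag_mul _ _) _ => //.
apply: eqm_trans (eqm_cmul idJ _ IHw) _ => //; rewrite !expo_cons.
have -> : diag (quat_syl x y rot (i, e)) = twist (qim (axis x y i)) (rot i e).
  by case: i => [[|[|[|//]]] ?]; rewrite /diag /twist /quat_syl /about /= mulr0 addr0.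
have J0 : J (1 - 1 ^+ 2) by rewrite expr1n subrr; apply: (ideal_zero idJ).
have tw (i' : 'I_3) e' z : J (1 - e' ^+ 2) -> forall c,
  eqm J (cmul (twist e' (rot i' e)) (cmul (twist e' (rot i' z)) c))
        (cmul (twist e' (rot i' (e + z))) c).
  move=> Je' c; rewrite cmulA rotD cmulC [X in eqm _ _ X]cmulC.
  by apply: eqm_cmul => //; apply: eqm_twist.
case: i => [[|[|[|//]]] Hi]; rewrite /= ?add0n.
- by rewrite (bool_irrelevance Hi isT); apply: tw.
- rewrite (bool_irrelevance Hi isT) cmulCA; apply: eqm_cmul => //; exact: tw.
rewrite (bool_irrelevance Hi isT) cmulCA; apply: eqm_cmul => //.
rewrite cmulCA; apply: eqm_cmul => //; rewrite rotD.
exact: eqm_twist.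
Qed.
End Abelianization.

(** * The polynomials P_n and powers of rotations *)

Lemma Pq_rec n : Pq n.+2 = 2%:R *: 'X * Pq n.+1 - Pq n.
Proof. by rewrite /Pq /=; case: (Ppair n). Qed.

(** With integer coefficients, [ratr] is only evaluated at integers, and the recursion carries over
    to F. Two consecutive indices are needed for the two-step recursion. *)
Lemma Pq_int n : exists p q : {poly int},
  Pq n = map_poly intr p /\ Pq n.+1 = map_poly intr q.
Proof.
elim: n => [|n [p [q [pE qE]]]].
  by exists 0, 1; rewrite rmorph0 rmorph1.
exists q, (2%:R *: 'X * q - p); split=> //.
rewrite Pq_rec pE qE rmorphB rmorphM /= map_polyZ map_polyX.
by rewrite rmorph_nat.
Qed.

Section Chebyshev.
Variable F : fieldType.

Lemma PF_int n p : Pq n = map_poly intr p -> PF F n = map_poly intr p.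
Proof.
move=> pE; rewrite /PF pE; apply/polyP => i.
by rewrite coef_map_id0 ?coef_map ?coef_map_id0 /= ?(ratr_int _ 0) ?ratr_int.
Qed.

Lemma PF0 : PF F 0 = 0.
Proof. by rewrite (@PF_int 0 0) ?rmorph0. Qed.

Lemma PF1 : PF F 1 = 1.
Proof. by rewrite (@PF_int 1 1) ?rmorph1. Qed.

Lemma PF_rec n mu :
  (PF F n.+2).[mu] = 2%:R * mu * (PF F n.+1).[mu] - (PF F n).[mu].
Proof.
have [p [q [pE qE]]] := Pq_int n.
have E2 : Pq n.+2 = map_poly intr (2%:R *: 'X * q - p).
  rewrite Pq_rec pE qE rmorphB rmorphM /= map_polyZ map_polyX.
  by rewrite rmorph_nat.
rewrite (PF_int pE) (PF_int qE) (PF_int E2) rmorphB rmorphM /= map_polyZ map_polyX.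
by rewrite rmorph_nat !hornerE.
Qed.

Variables mu s : F.
Hypothesis mus : s ^+ 2 + mu ^+ 2 = 1.

(** De Moivre: sin(n t) = sin(t) P_n(cos t), with mu and s as cosine and sine. *)
Lemma cpow_PF n : (cpow (mu, s) n).2 = s * (PF F n).[mu].
Proof.
suff [] : (cpow (mu, s) n).2 = s * (PF F n).[mu] /\
  (cpow (mu, s) n.+1).2 = s * (PF F n.+1).[mu] by [].
elim: n => [|n [IH0 IH1]].
  by rewrite PF0 PF1 /cpow /= !hornerE /= ?mulr0 ?mulr1 ?mul0r ?add0r ?addr0.
split=> //; rewrite PF_rec mulrBr (mulrCA s) -IH0 -IH1 /cpow /= -/(cpow _ n).
apply/eqP; rewrite -subr_eq0; apply/eqP.
(* This is z^2 = 2 mu z - |z|^2 for z = mu + i s, with |z|^2 = 1. *)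
transitivity ((1 - (s ^+ 2 + mu ^+ 2)) * (cpow (mu, s) n).2); first by rewrite /=; ring.
by rewrite mus subrr mul0r.
Qed.

Lemma cpow_norm n : (cpow (mu, s) n).1 ^+ 2 + (cpow (mu, s) n).2 ^+ 2 = 1.
Proof.
elim: n => [|n IHn]; first by rewrite /cpow /= expr1n expr0n addr0.
rewrite -[RHS]mulr1 -{1}mus -IHn /cpow /= -/(cpow _ n); ring.
Qed.

Lemma cpow_root n : root (PF F n) mu ->
  exists b : bool, cpow (mu, s) n = ((-1) ^+ b, 0).
Proof.
move=> /rootP pn; have := cpow_PF n; have := cpow_norm n.
rewrite pn mulr0; case: (cpow _ _) => c d /= + d0; rewrite d0 expr0n addr0 => /eqP.
by rewrite sqrf_eq1 => /orP[] /eqP ->; [exists false | exists true].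
Qed.

(** If s = 0 then mu^2 = 1 and P_(n+1)(mu) = mu^n (n+1), nonzero in characteristic 0. Hence s_1 is
    invertible. *)
Lemma PF_unit_neq0 : [pchar F] =i pred0 -> s = 0 -> forall n, ~~ root (PF F n.+1) mu.
Proof.
move=> /pcharf0P char0 s0 n.
have mu2 : mu * mu = 1 by rewrite -mus s0 expr0n add0r.
(* As mu is its own inverse, mu * mu^n stands for mu^(n-1) and covers n = 0. *)
have pn : (PF F n).[mu] = mu * (mu ^+ n * n%:R) /\ (PF F n.+1).[mu] = mu ^+ n * n.+1%:R.
  elim: n => [|n [IH0 IH1]].
    by rewrite PF0 PF1 !hornerE mulr0n expr0 /= ?mulr0 ?mulr1; split; rewrite ?mulr0.
  split; first by rewrite IH1 exprS !mulrA mu2 mul1r.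
  by rewrite PF_rec IH0 IH1 exprS; ring.
rewrite rootE pn.2 mulf_eq0 negb_or char0 andbT expf_neq0 //.
by apply/eqP => mu0; move/eqP: mu2; rewrite mu0 mul0r eq_sym oner_eq0.
Qed.
End Chebyshev.

Lemma cpow_map (R S : comNzRingType) (f : {rmorphism R -> S}) a b n :
  cpow (f a, f b) n = (f (cpow (a, b) n).1, f (cpow (a, b) n).2).
Proof.
elim: n => [|n IHn]; first by rewrite /cpow /= rmorph1 rmorph0.
rewrite /cpow /= -!/(cpow _ n) IHn /cmul /=.
by rewrite rmorphB rmorphD !rmorphM.
Qed.

(** * Finitely generated ideals and represented elements *)

Definition lin_span (R : comNzRingType) (g : seq R) (z : R) : Prop :=
  exists c : nat -> R, z = \sum_(i < size g) c i * g`_i.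

Lemma lin_span_ideal (R : comNzRingType) (g : seq R) : prop_ideal (lin_span g).
Proof.
split=> [|a b [c ->] [d ->]|a b [c ->]].
- by exists (fun=> 0); rewrite big1 // => i _; rewrite mul0r.
- by exists (fun i => c i + d i); rewrite -big_split; apply: eq_bigr => i _; rewrite mulrDl.
by exists (fun i => a * c i); rewrite mulr_sumr; apply: eq_bigr => i _; rewrite mulrA.
Qed.

Lemma lin_span_nth (R : comNzRingType) (g : seq R) i :
  (i < size g)%N -> lin_span g g`_i.
Proof.
move=> ig; exists (fun j => (j == i)%:R).
rewrite (bigD1 (Ordinal ig)) //= eqxx mul1r big1 ?addr0 // => j.
by rewrite -val_eqE /= => /negPf ->; rewrite mul0r.
Qed.


(** The row q1^T M is (gd0, gd1, gb0, gb1), whence the order k3, k4, k1, k2. *)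
Lemma gram_represented (R : comNzRingType) (x y u v p0 p1 q0 q1 k1 k2 k3 k4 : R) :
  let w := Quat 0 0 p0 p1 q0 q1 in
  let rows := [:: [:: u; v; 1 - x ^+ 2; 0]; [:: - v; u; 0; 1 - x ^+ 2];
                  [:: 1 - y ^+ 2; 0; u; - v]; [:: 0; 1 - y ^+ 2; v; u]] in
  ((\col_(i < 4) nth 0 [:: p0; p1; q0; q1] i)^T
    *m (\matrix_(i < 4, j < 4) nth 0 (nth [::] rows i) j)
    *m \col_(i < 4) nth 0 [:: k3; k4; k1; k2] i) 0 0 =
  k1 * gb0 x u v w + k2 * gb1 x u v w + k3 * gd0 y u v w + k4 * gd1 y u v w.
Proof.
rewrite /= !mxE !big_ord_recr !big_ord0 /= !mxE !big_ord_recr !big_ord0 /= !mxE /=.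
rewrite /gb0 /gb1 /gd0 /gd1 /=; ring.
Qed.

(** * The unit ideal obtained from a normal generator *)

Section UnitIdeal.
Variables (R : comNzRingType) (x y u v : R) (r s t : nat) (w : word).
Variables (mu si : 'I_3 -> R) (a : 'I_3 -> nat) (d : R).
Hypotheses (cord_gt0 : forall i, (0 < cord r s t i)%N).
Hypothesis a_inv : forall i, exists k, (a i * expo i w = 1 + k * cord r s t i)%N.
Hypothesis gen_order : forall i,
  exists b : bool, cpow (mu i, si i) (cord r s t i) = ((-1) ^+ b, 0).
Hypothesis gen : normally_generates r s t w.
Local Notation g0 := (@Ordinal 3 0 isT).
Local Notation g1 := (@Ordinal 3 1 isT).
Local Notation g2 := (@Ordinal 3 2 isT).
Hypothesis dV : d * si g0 = 1.

Lemma normally_generates_unit : exists q h g c1 c2 c3 c4 k1 k2 k3 k4,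
  (k1 * gb0 x u v q + k2 * gb1 x u v q + k3 * gd0 y u v q + k4 * gd1 y u v q)
  + g * (- (si g0 ^+ 2 * si g1 * si g2) * x * y + mu g0 * mu g2 * si g0 * si g1 * x
         + mu g0 * mu g1 * si g0 * si g2 * y + si g0 ^+ 2 * mu g1 * mu g2
         + (c1 * u + c2 * v + c3 * (1 - x ^+ 2) + c4 * (1 - y ^+ 2)))
  + h * gram_rel x y u v = 1.
Proof.
(* Raising the i-th rotation to the power a i makes w abelianize to the product of the
   three rotations. *)
pose rot i e := cpow (mu i, si i) (a i * e).
have rot0 i : rot i 0 = (1, 0) by rewrite /rot muln0.
have rotD i e f : rot i (e + f) = cmul (rot i e) (rot i f).
  by rewrite /rot mulnDr cpowD.
have rot_order i : exists b : bool, rot i (cord r s t i) = ((-1) ^+ b, 0).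
  by have [b bE] := gen_order i; apply: cpow_sign bE.
have rot_expo i : exists b : bool, rot i (expo i w) = ((-1) ^+ b * mu i, (-1) ^+ b * si i).
  have [k kE] := a_inv i; have [b bE] := gen_order i.
  have [b' b'E] := cpow_sign k bE; exists b'.
  by rewrite /rot kE cpowD b'E /cpow /cmul /=; congr pair; ring.
pose q := quat_word x y u v rot w.
pose gs := [:: gram_rel x y u v; qim q; gb0 x u v q; gb1 x u v q; gd0 y u v q; gd1 y u v q].
have idI := lin_span_ideal gs; have mem_gs := @lin_span_nth _ gs.
(* The chosen syllable goes to mu_1 + s_1 n1 up to sign, so s_1 lies in I up to sign. *)
have Is1 := @normally_generates_ideal _ x y u v rot _ idI (mem_gs 0%N isT) r s t cord_gt0
  rot0 rotD rot_order w g0 (expo g0 w) gen (mem_gs 1%N isT)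
  (mem_gs 2%N isT) (mem_gs 3%N isT) (mem_gs 4%N isT) (mem_gs 5%N isT).
have [b0 rot_0] := rot_expo g0.
have [b1 rot_1] := rot_expo g1.
have [b2 rot_2] := rot_expo g2.
have [c cE] : lin_span gs 1.
  have := ideal_mul idI ((-1) ^+ b0 * d) Is1.
  by rewrite /quat_syl rot_0 /= mulr1 mulrACA -expr2 sqrr_sign mul1r dV.
pose gJ := [:: u; v; 1 - x ^+ 2; 1 - y ^+ 2].
have mem_gJ := @lin_span_nth _ gJ.
have [_] := @diag_quat_word _ x y u v _ (lin_span_ideal gJ) (mem_gJ 2%N isT) (mem_gJ 3%N isT)
  (mem_gJ 0%N isT) (mem_gJ 1%N isT) rot rot0 rotD w.
rewrite -/q rot_0 rot_1 rot_2 => -[j].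
rewrite !big_ord_recr !big_ord0 /= in cE *.
pose e : R := (-1) ^+ b0 * (-1) ^+ b1 * (-1) ^+ b2.
have ee : e * e = 1 by rewrite /e -2!signr_addb -expr2 sqrr_sign.
move=> /eqP; rewrite subr_eq add0r => /eqP jE.
pose z := si g0 * e.
(* Since d inverts s_1 and e^2 = 1, [qim q] equals d e (z [qim q]), which gives the coefficient of W
   + alpha. *)
exists q, (c 0%N), (c 1%N * d * e), (z * j 0%N), (z * j 1%N), (z * j 2%N), (z * j 3%N),
  (c 2%N), (c 3%N), (c 4%N), (c 5%N).
rewrite [RHS]cE; set W := (X in _ * (X + _)).
(* W is s_1 times the imaginary part of (mu_1 + i s_1)(mu_2 + i x s_2)(mu_3 + i y s_3); the factor e
   cancels the three signs. *)
have zq : z * qim q = W + z * (j 0%N * u + j 1%N * v + j 2%N * (1 - x ^+ 2) + j 3%N * (1 - y ^+ 2)).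
  rewrite jE mulrDr [LHS]addrC; congr (_ + _).
  by transitivity (e * e * W); [rewrite /W /z /e /=; ring | rewrite ee mul1r].
have -> : c 1%N * qim q = c 1%N * d * e * (z * qim q).
  by transitivity (c 1%N * (d * si g0) * (e * e) * qim q); [rewrite dV ee; ring | rewrite /z; ring].
rewrite zq /W; ring.

Qed.
End UnitIdeal.


(** * From the field F to a ring over it *)

Section Extension.
Variables (F : fieldType) (R : comNzRingType) (f : {rmorphism F -> R}) (x y u v : R).
Variables (r s t : nat) (mu1 mu2 mu3 s1 s2 s3 : F).
Hypotheses (r_gt1 : (1 < r)%N) (s_gt1 : (1 < s)%N) (t_gt1 : (1 < t)%N).
Hypothesis char0 : [pchar F] =i pred0.
Hypotheses (root1 : root (PF F r) mu1) (root2 : root (PF F s) mu2) (root3 : root (PF F t) mu3).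
Hypotheses (norm1 : s1 ^+ 2 + mu1 ^+ 2 = 1) (norm2 : s2 ^+ 2 + mu2 ^+ 2 = 1)
  (norm3 : s3 ^+ 2 + mu3 ^+ 2 = 1).

Lemma cpow_root_map mu si n : si ^+ 2 + mu ^+ 2 = 1 -> root (PF F n) mu ->
  exists b : bool, cpow (f mu, f si) n = ((-1) ^+ b, 0).
Proof.
move=> mus pn; have [b cb] := cpow_root mus pn; exists b.
by rewrite cpow_map cb /= rmorph_sign rmorph0.
Qed.

(** R is any ring with a morphism from F, and the relation of A enters as a multiple of [gram_rel],
    so the quotient A is never formed. *)
Lemma not_normally_generates :
  (forall (q1 q2 : 'cV[R]_4) (c1 c2 c3 c4 : R),
     ~ exists e g h : R,
         e * (q1^T *m (\matrix_(i < 4, j < 4) nth 0 (nth [::]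
               [:: [:: u; v; 1 - x ^+ 2; 0]; [:: - v; u; 0; 1 - x ^+ 2];
                   [:: 1 - y ^+ 2; 0; u; - v]; [:: 0; 1 - y ^+ 2; v; u]] i) j) *m q2) 0 0
         + g * (- f (s1 ^+ 2 * s2 * s3) * x * y + f (mu1 * mu3 * s1 * s2) * x
                + f (mu1 * mu2 * s1 * s3) * y + f (s1 ^+ 2 * mu2 * mu3)
                + (c1 * u + c2 * v + c3 * (1 - x ^+ 2) + c4 * (1 - y ^+ 2)))
         + h * gram_rel x y u v = 1) ->
  forall w : word, ~ normally_generates r s t w.
Proof.
move=> proper w gen.
have s1_neq0 : s1 != 0.
  apply/eqP => s10; move: root1; rewrite -(prednK (ltnW r_gt1)).
  by apply/negP; apply: PF_unit_neq0 norm1 char0 s10 _.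
have cord_gt0 := cord_gt0 r_gt1 s_gt1 t_gt1.
have [a aP] := fin_all_exists (fun i => normally_generates_inverse r_gt1 s_gt1 t_gt1 i gen).
pose mu (i : 'I_3) : R := nth 0 [:: f mu1; f mu2; f mu3] i.
pose si (i : 'I_3) : R := nth 0 [:: f s1; f s2; f s3] i.
have gen_order i : exists b : bool, cpow (mu i, si i) (cord r s t i) = ((-1) ^+ b, 0).
  by case: i => [[|[|[|//]]] ?]; apply: cpow_root_map.
have s1V : f s1^-1 * f s1 = 1 by rewrite -rmorphM mulVf ?rmorph1.
have [q [h [g [c1 [c2 [c3 [c4 [k1 [k2 [k3 [k4 E]]]]]]]]]]] :=
  @normally_generates_unit _ x y u v r s t w mu si a _ cord_gt0 aP gen_order gen s1V.
case: q E => w0 w1 p0 p1 q0 q1 E.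
apply: (proper (\col_(i < 4) nth 0 [:: p0; p1; q0; q1] i)
  (\col_(i < 4) nth 0 [:: k3; k4; k1; k2] i) c1 c2 c3 c4).
(* The coefficients of the inner products are already in the second column, so the represented
   element occurs with factor 1. *)
by exists 1, g, h; rewrite mul1r gram_represented !(rmorphM, rmorphXn).
Qed.
End Extension.

(** [mC] written as a composition, so that its ring morphism structure can be inferred. *)
Definition const4 (F : fieldType) : F -> mpoly4 F :=
  @polyC {poly {poly {poly F}}} \o (@polyC {poly {poly F}} \o (@polyC {poly F} \o @polyC F)).

HB.instance Definition _ (F : fieldType) := GRing.RMorphism.on (@const4 F).

Theorem mainTheorem20 (r s t : nat) (F : fieldType) (mu1 mu2 mu3 s1 s2 s3 : F) :
  (1 < r)%N -> (1 < s)%N -> (1 < t)%N ->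
  [pchar F] =i pred0 ->
  root (PF F r) mu1 -> root (PF F s) mu2 -> root (PF F t) mu3 ->
  s1 ^+ 2 + mu1 ^+ 2 = 1 -> s2 ^+ 2 + mu2 ^+ 2 = 1 -> s3 ^+ 2 + mu3 ^+ 2 = 1 ->
  (forall (q1 q2 : 'cV[mpoly4 F]_4) (c1 c2 c3 c4 : mpoly4 F),
     ~ exists f g h : mpoly4 F,
         f * (q1^T *m Mmat F *m q2) 0 0
         + g * (Wpoly mu1 mu2 mu3 s1 s2 s3 + Jcomb c1 c2 c3 c4)
         + h * Rel F = 1) ->
  forall w : word, ~ normally_generates r s t w.
Proof.
move=> r_gt1 s_gt1 t_gt1 char0 root1 root2 root3 norm1 norm2 norm3.
exact: (@not_normally_generates F (mpoly4 F) (@const4 F) (mx F) (my F) (mu_ F) (mv F)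
  r s t mu1 mu2 mu3 s1 s2 s3).
Qed.
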